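(* Let $\lambda$ be a weakly compact cardinal. Then there are exactly $2$ precomplete (maximal) clones on $\lambda$ which contain all unary functions $\lambda\to\lambda$.
   Context: $\mathscr{O}^{(n)}$ is the set of all functions $\lambda^n\to\lambda$ ($n\ge1$), $\mathscr{O}=\bigcup_{n\ge1}\mathscr{O}^{(n)}$. A clone on $\lambda$ is a set $\mathscr{C}\subseteq\mathscr{O}$ containing all projections $\pi^n_k(x_1,\dots,x_n)=x_k$ and closed under composition (if $f_1,\dots,f_k\in\mathscr{C}$ are $n$-ary and $g\in\mathscr{C}$ is $k$-ary, then $g(f_1,\dots,f_k)\in\mathscr{C}$). A clone $\mathscr{C}\neq\mathscr{O}$ is precomplete (= maximal) if the only clone properly containing it is $\mathscr{O}$. A cardinal $\lambda$ is weakly compact if it is uncountable and $\lambda\to(\lambda)^2_2$ holds, i.e., for every $h:[\lambda]^2\to\{0,1\}$ (where $[\lambda]^2$ is the set of 2-element subsets of $\lambda$) there is $S\subseteq\lambda$ with $|S|=\lambda$ such that $h\restriction[S]^2$ is constant. *)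

(* Defs.v *)
From mathcomp Require Import all_boot.
From mathcomp Require Import boolp classical_sets functions cardinality.

Set Implicit Arguments.
Unset Strict Implicit.
Unset Printing Implicit Defensive.

Local Open Scope classical_set_scope.
Local Open Scope card_scope.

(* A cardinal lambda is represented by a type T of that cardinality: clones on
   lambda only depend on its underlying set. *)

(* [S]^2 *)
Definition pairs (T : Type) (S : set T) : set (set T) :=
  [set A | A `<=` S /\ A #= `I_2].

(* Colourings of [T]^2 are given as total functions on sets; their values
   outside [T]^2 play no role. *)
Definition weakly_compact (T : Type) : Prop :=
  ~ countable [set: T] /\
  forall h : set T -> bool, exists S : set T,
    S #= [set: T] /\ exists c : bool, forall A, pairs S A -> h A = c.

Definition opn (T : Type) (n : nat) : Type := ('I_n -> T) -> T.

(* The disjoint union of the sets of n-ary operations over the arities n >= 1: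
   the tag n stands for the arity n.+1. *)
Definition op (T : Type) : Type := {n : nat & opn T n.+1}.

Definition mkop (T : Type) (n : nat) (f : opn T n.+1) : op T :=
  existT (fun m => opn T m.+1) n f.

Definition proj (T : Type) (n : nat) (k : 'I_n) : opn T n := fun x => x k.

Definition comp (T : Type) (n k : nat) (g : opn T k) (f : 'I_k -> opn T n) :
  opn T n := fun x => g (fun i => f i x).

Definition unary (T : Type) (f : T -> T) : op T :=
  @mkop T 0 (fun x => f (x ord0)).

Definition clone (T : Type) (C : set (op T)) : Prop :=
  (forall n (k : 'I_n.+1), C (mkop (@proj T n.+1 k))) /\
  (forall n k (g : opn T k.+1) (f : 'I_k.+1 -> opn T n.+1),
     C (mkop g) -> (forall i, C (mkop (f i))) -> C (mkop (comp g f))).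

Definition precomplete (T : Type) (C : set (op T)) : Prop :=
  [/\ clone C, C <> [set: op T] &
      forall D : set (op T), clone D -> C `<` D -> D = [set: op T]].

(* Main.v *)
Require Import Defs.
From mathcomp Require Import all_boot.
From mathcomp Require Import boolp classical_sets functions cardinality.
From mathcomp Require wochoice.

Set Implicit Arguments.
Unset Strict Implicit.

Local Open Scope classical_set_scope.
Local Open Scope card_scope.

(** The set T is well-ordered in its initial order type, which is regular
    because the partition property colours away any short cofinal family. From
    then on cardinality disappears: a set has full cardinality exactly when it
    is unbounded, and strictly increasing self-maps e of T play the role of
    large subsets of T (passing to a subset means composing with e).

    The two maximal clones are the following.
    - split_bounded consists of the operations f such that, whenever the
      arguments of f are split into two groups, keeping the arguments of one of
      the groups below a bound keeps the value of f below a bound.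
    - never_injective consists of the operations f which cannot be turned into
      a binary function injective on the triangle x < y by substituting a unary
      function of x or of y for each argument.

    Neither contains the other: the maximum of two elements is only in the
    second, and a code of the pairs x < y, put to a constant for x >= y, is
    only in the first. It is therefore enough to see that a clone D containing
    the unary operations and contained in neither is everything
    (unbounded_and_injective_generate). Since T is in bijection with its square,
    this amounts to finding an injective binary operation in D. An operation
    outside never_injective provides q injective on the triangle x < y. The
    partition property lets one assume that q(y,x) and q(x,y) are always equal,
    in which case q codes unordered pairs, or that the values of q below the
    diagonal differ from all its values above it. In the latter case, an
    operation outside split_bounded provides h such that h(.,c) and h(c,.) are
    injective with disjoint ranges on a large set, and a unary function w sends
    the values of q below the diagonal to c and those above it injectively into
    this large set: then (x,y) |-> h(w(q(x,y)), w(q(y,x))) codes ordered pairs off the diagonal, and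
    substituting maps with disjoint ranges avoids the diagonal.

    The Ramsey theory behind this is the partition relation for quadruples,
    deduced from the one for pairs by colouring pairs with a lexicographic order
    (stabilization, ramsey4). It implies that every binary function is, on the
    triangle x < y of a large set, either injective or a function of one of its
    two arguments (canonical), which is also why never_injective is a clone. *)

(** * Well-orders with the Ramsey property *)

(** In a well-order of initial type, boundedness stands for being of smaller
    cardinality: ro_regular is the regularity of the cardinal and ro_homogeneous
    its partition relation for pairs. *)
Record ramsey_order (T : Type) (lt : T -> T -> Prop) : Prop := RamseyOrder {
  ro_wf : well_founded lt;
  ro_trans : forall x y z, lt x y -> lt y z -> lt x z;
  ro_total : forall x y, [\/ lt x y, x = y | lt y x];
  ro_nomax : forall x, exists y, lt x y;
  ro_regular : forall (F : T -> T) a, exists b, forall x, lt x a -> lt (F x) b;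
  ro_homogeneous : forall P : T -> T -> Prop, exists S : T -> Prop,
    (forall b, exists2 s, S s & lt b s) /\
    ((forall x y, S x -> S y -> lt x y -> P x y) \/
     (forall x y, S x -> S y -> lt x y -> ~ P x y)) }.

Lemma functional_choice X Y (P : X -> Y -> Prop) :
  (forall x, exists y, P x y) -> exists f, forall x, P x (f x).
Proof. by move=> /choice[f fP]; exists f. Qed.

Section RamseyOrder.
Variables (T : Type) (lt : T -> T -> Prop).
Hypothesis ltP : ramsey_order lt.
Local Notation "x ≺ y" := (lt x y) (at level 70).

Let lt_trans {x y z} : x ≺ y -> y ≺ z -> x ≺ z :=
  fun xy yz => ro_trans ltP xy yz.

Lemma ro_irr x : ~ x ≺ x.
Proof. by elim/(well_founded_ind (ro_wf ltP)): x => x IH xx; exact: (IH x xx xx). Qed.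

Lemma ro_nlt_lt x y z : ~ y ≺ x -> y ≺ z -> x ≺ z.
Proof.
by move=> nyx yz; case: (ro_total ltP x y) => [xy|->|]//; exact: lt_trans xy yz.
Qed.

Lemma ro_lt_nlt x y z : x ≺ y -> ~ z ≺ y -> x ≺ z.
Proof.
by move=> xy nzy; case: (ro_total ltP y z) => [yz|<-|]//; exact: lt_trans xy yz.
Qed.

Lemma ro_ub2 x y : exists z, x ≺ z /\ y ≺ z.
Proof.
case: (ro_total ltP x y) => [xy|<-|yx].
- by have [z yz] := ro_nomax ltP y; exists z; split=> //; exact: lt_trans xy yz.
- by have [z yz] := ro_nomax ltP x; exists z.
- by have [z xz] := ro_nomax ltP x; exists z; split=> //; exact: lt_trans yx xz.
Qed.

Lemma ro_max2 x y z : x ≺ z -> y ≺ z -> exists m, [/\ m ≺ z, ~ m ≺ x & ~ m ≺ y].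
Proof.
move=> xz yz; case: (EM (x ≺ y)) => xy.
- exists y; split=> //; last exact: ro_irr.
  by move=> yx; exact: ro_irr (lt_trans xy yx).
- by exists x; split=> //; exact: ro_irr.
Qed.

Lemma ro_bound2 (F : T -> T -> T) a :
  exists b, forall x y, x ≺ a -> y ≺ a -> F x y ≺ b.
Proof.
have [f fP] : exists f : T -> T, forall x y, y ≺ a -> F x y ≺ f x.
  by apply: (@functional_choice _ _ (fun x b => forall y, y ≺ a -> F x y ≺ b)) => x; exact: ro_regular ltP (F x) a.
have [b bP] := ro_regular ltP f a.
by exists b => x y xa ya; exact: lt_trans (fP _ _ ya) (bP _ xa).
Qed.

Lemma ro_bound3 (F : T -> T -> T -> T) a :
  exists b, forall x y z, x ≺ a -> y ≺ a -> z ≺ a -> F x y z ≺ b.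
Proof.
have [f fP] : exists f : T -> T, forall x y z, y ≺ a -> z ≺ a -> F x y z ≺ f x.
  apply: (@functional_choice _ _ (fun x b => forall y z, y ≺ a -> z ≺ a -> F x y z ≺ b)) => x.
  exact: ro_bound2.
have [b bP] := ro_regular ltP f a.
by exists b => x y z xa ya za; exact: lt_trans (fP _ _ _ ya za) (bP _ xa).
Qed.

Definition unbounded (S : T -> Prop) := forall b, exists2 s, S s & b ≺ s.

Definition incr (e : T -> T) := forall x y, x ≺ y -> e x ≺ e y.

Lemma incr_comp e e' : incr e -> incr e' -> incr (e \o e').
Proof. by move=> ei ei' x y xy; apply/ei/ei'. Qed.

Lemma incr_nlt e x y : incr e -> ~ y ≺ x -> ~ e y ≺ e x.
Proof.
move=> ei nyx; case: (ro_total ltP x y) => [xy|<-|//]; last exact: ro_irr.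
by move=> yx; exact: ro_irr (lt_trans yx (ei _ _ xy)).
Qed.

Lemma incr_inj e : incr e -> injective e.
Proof.
move=> ei x y exy; case: (ro_total ltP x y) => [/ei|//|/ei]; rewrite exy => h;
by case: (ro_irr h).
Qed.

Lemma incr_ge e x : incr e -> ~ e x ≺ x.
Proof.
move=> ei; elim/(well_founded_ind (ro_wf ltP)): x => x IH exx.
exact: IH exx (ei _ _ exx).
Qed.

(** By recursion, e x is an element of S beyond a bound, given by regularity,
    of M (e y) for all y before x, where M dominates both N and the identity. *)
Lemma sparse_enumeration (S : T -> Prop) (N : T -> T) : unbounded S ->
  exists e, [/\ incr e, (forall x, S (e x)) & forall x y, x ≺ y -> N (e x) ≺ e y].
Proof.
move=> Sub.
have [M MP] : exists M : T -> T, forall x, x ≺ M x /\ N x ≺ M x.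
  by apply: (@functional_choice _ _ (fun x m => x ≺ m /\ N x ≺ m)) => x; exact: ro_ub2.
have [nxt nxtP] : exists nxt : (T -> T) -> T -> T,
    forall f x, S (nxt f x) /\ (forall y, y ≺ x -> M (f y) ≺ nxt f x).
  have [g gP] : exists g : (T -> T) * T -> T, forall p,
      S (g p) /\ (forall y, y ≺ p.2 -> M (p.1 y) ≺ g p).
    apply: (@functional_choice _ _ (fun p b => S b /\ (forall y, y ≺ p.2 -> M (p.1 y) ≺ b))).
    move=> [f x] /=; have [b bP] := ro_regular ltP (M \o f) x.
    have [s Ss bs] := Sub b; exists s; split=> // y /bP h; exact: lt_trans h bs.
  by exists (fun f x => g (f, x)) => f x; exact: (gP (f, x)).
(* nxt only reads values before x; ext is completed with x to a total function. *)
pose ext x (g : forall y, y ≺ x -> T) (z : T) : T :=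
  if pselect (z ≺ x) is left h then g z h else x.
pose e := Fix (ro_wf ltP) (fun=> T) (fun x g => nxt (ext x g) x).
have eE x : exists2 f, e x = nxt f x & forall y, y ≺ x -> f y = e y.
  exists (ext x (fun y _ => e y)).
    rewrite {1}/e Fix_eq// => z f g fg; congr nxt.
    by apply: funext => w; rewrite /ext; case: pselect.
  by move=> y yx; rewrite /ext; case: pselect.
have eM x y : x ≺ y -> M (e x) ≺ e y.
  move=> xy; have [f -> fe] := eE y; rewrite -(fe _ xy).
  by case: (nxtP f y) => _; exact.
exists e; split.
- by move=> x y /eM; apply: lt_trans; case: (MP (e x)).
- by move=> x; have [f -> _] := eE x; case: (nxtP f x).
- by move=> x y /eM; apply: lt_trans; case: (MP (e x)).
Qed.

Lemma sparse_incr (N : T -> T) :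
  exists e, incr e /\ forall x y, x ≺ y -> N (e x) ≺ e y.
Proof.
have [|e [ei _ eN]] := sparse_enumeration (S := fun=> True) N; last by exists e.
by move=> b; have [y] := ro_nomax ltP b; exists y.
Qed.

Lemma disjoint_incr : exists a b, [/\ incr a, incr b & forall x y, a x <> b y].
Proof.
have [N NP] := choice (ro_nomax ltP).
have [e [ei eN]] := sparse_incr N.
exists e, (N \o e); split=> //.
- by move=> x y /eN h; exact: lt_trans h (NP _).
- move=> x y /=; case: (ro_total ltP y x) => [/eN h eq|<- eq|/ei h eq].
  + by apply: (ro_irr (x := e x)); rewrite {1}eq.
  + by apply: (ro_irr (x := e y)); rewrite {2}eq.
  + by apply: (ro_irr (x := e x)); rewrite {2}eq; exact: lt_trans h (NP _).
Qed.

Definition delta_inj (F : T -> T -> T) := forall x y x' y',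
  x ≺ y -> x' ≺ y' -> F x y = F x' y' -> x = x' /\ y = y'.

(** The columns of index y are given disjoint blocks of T: the block of y starts
    at B y, beyond all the values used in the earlier columns. *)
Lemma delta_code : exists q, delta_inj q.
Proof.
have [s sP] : exists s : T -> T -> T, forall b, incr (s b) /\ forall x, b ≺ s b x.
  apply: (@functional_choice _ _ (fun b e => incr e /\ forall x, b ≺ e x)) => b.
  have [|e [ei eS _]] := sparse_enumeration (S := fun x => b ≺ x) id; last by exists e.
  by move=> c; have [z [bz cz]] := ro_ub2 b c; exists z.
have [N NP] : exists N : T -> T, forall b x, x ≺ b -> s b x ≺ N b.
  by apply: (@functional_choice _ _ (fun b c => forall x, x ≺ b -> s b x ≺ c)) => b; exact: ro_regular ltP (s b) b.
have [B [Bi BN]] := sparse_incr N.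
have sep x y x' y' : x ≺ y -> x' ≺ y' -> y ≺ y' -> s (B y) x ≺ s (B y') x'.
  move=> xy xy' yy'; have h1 := NP (B y) x.
  have h2 : x ≺ B y by exact: ro_lt_nlt xy (@incr_ge B y Bi).
  exact: lt_trans (h1 h2) (lt_trans (BN _ _ yy') ((sP (B y')).2 x')).
exists (fun x y => s (B y) x) => x y x' y' xy xy'.
case: (ro_total ltP y y') => [yy'|<-|yy'] eq.
- by have := sep _ _ _ _ xy xy' yy'; rewrite eq => /ro_irr.
- by split=> //; exact: incr_inj (sP (B y)).1 _ _ eq.
- by have := sep _ _ _ _ xy' xy yy'; rewrite eq => /ro_irr.
Qed.

(** A point (x,y) is moved off the diagonal to (a x, b y); the triangle in which
    it falls is recorded by applying a or b to the code. *)
Lemma pairing : exists p : T -> T -> T, forall x y x' y',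
  p x y = p x' y' -> x = x' /\ y = y'.
Proof.
have [q qi] := delta_code; have [a [b [ai bi ab]]] := disjoint_incr.
exists (fun x y => if pselect (a x ≺ b y) then a (q (a x) (b y)) else b (q (b y) (a x))).
have lt' x y : ~ a x ≺ b y -> b y ≺ a x.
  by move=> h; case: (ro_total ltP (a x) (b y)) => // /ab.
move=> x y x' y'; case: pselect => h; case: pselect => h' eq.
- have [|||/(incr_inj ai) -> /(incr_inj bi) ->] := qi (a x) (b y) (a x') (b y') => //.
  exact: incr_inj ai _ _ eq.
- by case: (ab _ _ eq).
- by case: (ab _ _ (esym eq)).
- have [|||/(incr_inj bi) -> /(incr_inj ai) ->] := qi (b y) (a x) (b y') (a x') => //.
  + exact: lt'.
  + exact: lt'.
  + exact: incr_inj bi _ _ eq.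
Qed.

(** Compare the elements of T by the lexicographic order of their sequences of
    truth values. On a set homogeneous for the colour telling whether the order
    of T agrees with it, the truth value of each property is monotone, hence
    eventually constant, as soon as the earlier properties have stabilized. *)
Lemma stabilization (I : Type) (i0 : T -> I) (P : I -> T -> Prop) :
    (forall i, exists t, i0 t = i) ->
  exists2 S, unbounded S & forall i, exists b,
    (forall y, S y -> b ≺ y -> P i y) \/ (forall y, S y -> b ≺ y -> ~ P i y).
Proof.
move=> i0s; pose Q t := P (i0 t).
(* Truth values are ordered with False first. *)
pose lex x y := exists i, [/\ forall j, j ≺ i -> (Q j x <-> Q j y), ~ Q i x & Q i y].
have [S [Sub hS]] := ro_homogeneous ltP lex.
exists S => // i; have [t <-] := i0s i; rewrite -/(Q t) {i}.
elim/(well_founded_ind (ro_wf ltP)): t => t IH.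
have [d dP] : exists d : T -> T, forall j, j ≺ t ->
    (forall y, S y -> d j ≺ y -> Q j y) \/ (forall y, S y -> d j ≺ y -> ~ Q j y).
  apply: (@functional_choice _ _ (fun j b => j ≺ t ->
    (forall y, S y -> b ≺ y -> Q j y) \/ (forall y, S y -> b ≺ y -> ~ Q j y))) => j.
  case: (EM (j ≺ t)) => [/IH[b bP]|nj]; first by exists b.
  by exists t.
have [b bP] := ro_regular ltP d t.
have agree x y : S x -> S y -> b ≺ x -> b ≺ y -> forall j, j ≺ t -> (Q j x <-> Q j y).
  move=> Sx Sy bx by_ j jt; have dj := bP _ jt.
  have djx := lt_trans dj bx; have djy := lt_trans dj by_.
  case: (dP _ jt) => h; first by split=> _; exact: h.
  by split=> [/(h x)|/(h y)] K; case: K.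
have next x y : S x -> S y -> b ≺ x -> x ≺ y ->
    (lex x y -> Q t x -> Q t y) /\ (~ lex x y -> Q t y -> Q t x).
  move=> Sx Sy bx xy; have by_ := lt_trans bx xy; have ag := agree _ _ Sx Sy bx by_.
  split.
    move=> [i [ji nx yi]] tx; case: (ro_total ltP i t) => [it|eq|ti].
    - by case: nx; apply/(ag _ it).
    - by move: nx; rewrite eq.
    - by apply/(ji _ ti).
  by move=> nlex ty; apply: contrapT => ntx; apply: nlex; exists t.
case: hS => hS.
- case: (EM (exists2 x, S x /\ b ≺ x & Q t x)) => [[x [Sx bx] tx]|no].
    exists x; left=> y Sy xy; apply: (next x y Sx Sy bx xy).1 tx.
    exact: hS.
  by exists b; right=> y Sy by_ ty; apply: no; exists y.
- case: (EM (exists2 x, S x /\ b ≺ x & ~ Q t x)) => [[x [Sx bx] tx]|no].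
    exists x; right=> y Sy xy ty; apply: tx.
    exact: (next x y Sx Sy bx xy).2 (hS _ _ Sx Sy xy) ty.
  by exists b; left=> y Sy by_; apply: contrapT => ty; apply: no; exists y.
Qed.

(** Stabilize all the properties P x y z of the last argument at once, then
    choose the elements so far apart that each is beyond the stabilization
    thresholds of the earlier triples. *)
Lemma end_homogeneous (P : T -> T -> T -> T -> Prop) :
  exists2 e, incr e & exists Q : T -> T -> T -> Prop, forall x y z t,
    x ≺ t -> y ≺ t -> z ≺ t -> (P (e x) (e y) (e z) (e t) <-> Q x y z).
Proof.
have [p pinj] := pairing.
have [dec decP] : exists dec : T -> T * T * T, forall i, exists t, dec t = i.
  have [d dP] : exists d : T -> T * T * T, forall t,
      (exists i, p (p i.1.1 i.1.2) i.2 = t) -> p (p (d t).1.1 (d t).1.2) (d t).2 = t.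
    apply: (@functional_choice _ _ (fun t (i : T * T * T) => (exists i, p (p i.1.1 i.1.2) i.2 = t) -> p (p i.1.1 i.1.2) i.2 = t)) => t.
    case: (EM (exists i, p (p i.1.1 i.1.2) i.2 = t)) => [[i it]|no]; first by exists i.
    by exists (t, t, t).
  exists d => -[[x y] z]; exists (p (p x y) z).
  have /pinj[/pinj[]] := dP _ (ex_intro _ (x, y, z) erefl).
  by case: (d _) => [[x' y'] z'] /= -> -> ->.
have [S Sub stab] := stabilization (fun i => P i.1.1 i.1.2 i.2) decP.
have [beta bP] : exists beta : T * T * T -> T, forall i,
    (forall y, S y -> beta i ≺ y -> P i.1.1 i.1.2 i.2 y) \/
    (forall y, S y -> beta i ≺ y -> ~ P i.1.1 i.1.2 i.2 y) by exact: functional_choice stab.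
have [N NP] : exists N : T -> T, forall m x y z,
    ~ m ≺ x -> ~ m ≺ y -> ~ m ≺ z -> beta (x, y, z) ≺ N m.
  apply: (@functional_choice _ _ (fun m b => forall x y z,
    ~ m ≺ x -> ~ m ≺ y -> ~ m ≺ z -> beta (x, y, z) ≺ b)) => m.
  have [m' mm'] := ro_nomax ltP m.
  have [b hb] := ro_bound3 (fun x y z => beta (x, y, z)) m'.
  by exists b => x y z hx hy hz; apply: hb; apply: ro_nlt_lt mm'.
have [e [ei eS eN]] := sparse_enumeration N Sub.
exists e => //.
exists (fun x y z => forall t, S t -> beta (e x, e y, e z) ≺ t -> P (e x) (e y) (e z) t).
move=> x y z t xt yt zt.
have [m [mt mx my]] := ro_max2 xt yt.
have [n [nt nm nz]] := ro_max2 mt zt.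
have le_n w : ~ m ≺ w -> ~ n ≺ w.
  by move=> mw nw; apply: mw; exact: ro_nlt_lt nm nw.
have bt : beta (e x, e y, e z) ≺ e t.
  apply: lt_trans (eN _ _ nt); apply: NP; apply: incr_nlt => //; exact: le_n.
split; last by apply.
move=> Pt; case: (bP (e x, e y, e z)) => // h.
by case: (h _ (eS t) bt).
Qed.

Definition homogeneous (e : T -> T) (P : T -> T -> T -> T -> Prop) :=
  (forall x y z t, x ≺ y -> y ≺ z -> z ≺ t -> P (e x) (e y) (e z) (e t)) \/
  (forall x y z t, x ≺ y -> y ≺ z -> z ≺ t -> ~ P (e x) (e y) (e z) (e t)).

Lemma homogeneous_comp e e' P :
  incr e' -> homogeneous e P -> homogeneous (e \o e') P.
Proof.
move=> ei' [h|h]; [left|right] => x y z t xy yz zt; by apply: h; apply: ei'.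
Qed.

(** End-homogeneity removes the last variable of P; doing so twice leaves a
    colouring of pairs. *)
Lemma ramsey4 P : exists2 e, incr e & homogeneous e P.
Proof.
have [e1 i1 [Q1 h1]] := end_homogeneous P.
have [e2 i2 [Q2 h2]] := end_homogeneous (fun=> Q1).
have [S [Sub hS]] := ro_homogeneous ltP (fun x y => Q2 x x y).
have [e3 [i3 S3 _]] := sparse_enumeration id Sub.
exists (e1 \o e2 \o e3); first by apply: incr_comp => //; exact: incr_comp.
have key x y z t : x ≺ y -> y ≺ z -> z ≺ t ->
    P (e1 (e2 (e3 x))) (e1 (e2 (e3 y))) (e1 (e2 (e3 z))) (e1 (e2 (e3 t))) <->
    Q2 (e3 x) (e3 x) (e3 y).
  move=> /i3 xy /i3 yz /i3 zt; have xz := lt_trans xy yz.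
  have := h2 _ _ _ _ xz xz yz; apply: iff_trans.
  by apply: h1; apply: i2 => //; [exact: lt_trans xz zt|exact: lt_trans yz zt].
case: hS => h; [left|right] => x y z t xy yz zt.
- by apply/(key _ _ _ _ xy yz zt)/h => //; exact: i3.
- by move/(key _ _ _ _ xy yz zt); apply: h => //; exact: i3.
Qed.

Lemma ramsey4_family (s : seq (T -> T -> T -> T -> Prop)) :
  exists2 e, incr e & foldr (fun P => and (homogeneous e P)) True s.
Proof.
elim: s => [|P s [e ei he]]; first by exists id.
have [e' ei' hP] := ramsey4 (fun x y z t => P (e x) (e y) (e z) (e t)).
exists (e \o e'); first exact: incr_comp.
split=> //; elim: s he => //= R s IH [hR hs]; split; last exact: IH.
exact: homogeneous_comp.
Qed.


Definition nondegenerate (F : T -> T -> T) :=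
  (forall x x' y, x ≺ x' -> x' ≺ y -> F x y <> F x' y) /\
  (forall x y y', x ≺ y -> y ≺ y' -> F x y <> F x y').

(** On a set homogeneous for the twelve possible relative positions of two
    distinct pairs, a collision in some position is a collision everywhere in
    that position. Moving a coordinate of the second pair which is not in the
    first then produces two equal values of F that nondegeneracy forbids. *)
Lemma collision_free (F G : T -> T -> T) : nondegenerate F ->
  exists2 e, incr e & forall x y x' y', x ≺ y -> x' ≺ y' ->
    G (e x) (e y) = F (e x') (e y') -> x = x' /\ y = y'.
Proof.
move=> [Fl Fr].
have [e ei] := ramsey4_family [::
  fun x y z t => G x y = F z t; fun x y z t => G x z = F y t;
  fun x y z t => G x t = F y z; fun x y z t => G y z = F x t;
  fun x y z t => G y t = F x z; fun x y z t => G z t = F x y;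
  fun x y z t => G x y = F x z; fun x y z t => G x z = F x y;
  fun x y z t => G x z = F y z; fun x y z t => G y z = F x z;
  fun x y z t => G x y = F y z; fun x y z t => G y z = F x y].
have {}Fl x x' y : x ≺ x' -> x' ≺ y -> F (e x) (e y) = F (e x') (e y) -> False.
  by move=> /ei xx' /ei; exact: Fl.
have {}Fr x y y' : x ≺ y -> y ≺ y' -> F (e x) (e y) = F (e x) (e y') -> False.
  by move=> /ei xy /ei; exact: Fr.
move=> hom; exists e => // x y x' y' xy xy'.
have [c2 c12] := ro_nomax ltP x; have [c3 c23] := ro_nomax ltP c2.
have [c4 c34] := ro_nomax ltP c3; have [c5 c45] := ro_nomax ltP c4.
have c13 := lt_trans c12 c23; have c24 := lt_trans c23 c34; have c35 := lt_trans c34 c45.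
have c14 := lt_trans c13 c34; have c25 := lt_trans c24 c45.
set c1 := x in c12 c13 c14.
move: hom => /= [h1 [h2 [h3 [h4 [h5 [h6 [h7 [h8 [h9 [h10 [h11 [h12 _]]]]]]]]]]]].
case: h1 => [h|h1].
  by case: (Fr c3 c4 c5) => //; rewrite -(h c1 c2 c3 c4)// -(h c1 c2 c3 c5).
case: h2 => [h|h2].
  by case: (Fr c2 c4 c5) => //; rewrite -(h c1 c2 c3 c4)// -(h c1 c2 c3 c5).
case: h3 => [h|h3].
  by case: (Fr c2 c3 c4) => //; rewrite -(h c1 c2 c3 c5)// -(h c1 c2 c4 c5).
case: h4 => [h|h4].
  by case: (Fr c1 c4 c5) => //; rewrite -(h c1 c2 c3 c4)// -(h c1 c2 c3 c5).
case: h5 => [h|h5].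
  by case: (Fr c1 c3 c4) => //; rewrite -(h c1 c2 c3 c5)// -(h c1 c2 c4 c5).
case: h6 => [h|h6].
  by case: (Fr c1 c2 c3) => //; rewrite -(h c1 c2 c4 c5)// -(h c1 c3 c4 c5).
case: h7 => [h|h7].
  by case: (Fr c1 c3 c4) => //; rewrite -(h c1 c2 c3 c5)// -(h c1 c2 c4 c5).
case: h8 => [h|h8].
  by case: (Fr c1 c2 c3) => //; rewrite -(h c1 c2 c4 c5)// -(h c1 c3 c4 c5).
case: h9 => [h|h9].
  by case: (Fl c2 c3 c4) => //; rewrite -(h c1 c2 c4 c5)// -(h c1 c3 c4 c5).
case: h10 => [h|h10].
  by case: (Fl c1 c2 c4) => //; rewrite -(h c1 c3 c4 c5)// -(h c2 c3 c4 c5).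
case: h11 => [h|h11].
  by case: (Fr c2 c3 c4) => //; rewrite -(h c1 c2 c3 c5)// -(h c1 c2 c4 c5).
case: h12 => [h|h12].
  by case: (Fl c1 c2 c3) => //; rewrite -(h c1 c3 c4 c5)// -(h c2 c3 c4 c5).
have [m ym] := ro_nomax ltP y; have [m' ym'] := ro_nomax ltP y'.
case: (ro_total ltP x x') => [xx'|exx|xx']; case: (ro_total ltP y y') => [yy'|eyy|yy'].
- case: (ro_total ltP y x') => [yx'|eyx|yx'] eq.
  + by case: (h1 x y x' y').
  + by case: (h11 x y y' m') => //; congruence.
  + by case: (h2 x x' y y').
- by move=> eq; case: (h9 x x' y m) => //; congruence.
- by move=> eq; case: (h3 x x' y' y).
- by move=> eq; case: (h7 x y y' m') => //; congruence.
- by [].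
- by move=> eq; case: (h8 x y' y m) => //; congruence.
- by move=> eq; case: (h4 x' x y y').
- by move=> eq; case: (h10 x' x y m) => //; congruence.
- case: (ro_total ltP y' x) => [yx'|eyx|yx'] eq.
  + by case: (h6 x' y' x y).
  + by case: (h12 x' x y m) => //; congruence.
  + by case: (h5 x' x y' y).
Qed.

(** If neither varying x alone nor varying y alone is harmless then, by
    homogeneity, varying one of them always changes the value, and
    collision_free applies to F and itself. *)
Lemma canonical (F : T -> T -> T) : exists2 e, incr e &
  delta_inj (fun x y => F (e x) (e y)) \/
  exists (b : bool) w, forall x y, x ≺ y -> F (e x) (e y) = w (if b then x else y).
Proof.
have [e ei [hl [hr _]]] := ramsey4_family [::
  fun x y z _ => F x z = F y z; fun x y z _ => F x y = F x z].
case: hl => [hl|hl].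
  exists e => //; right; exists false.
  suff [w h] : exists w, forall y x, x ≺ y -> F (e x) (e y) = w y.
    by exists w => x y; exact: h.
  apply: (@functional_choice _ _ (fun y v => forall x, x ≺ y -> F (e x) (e y) = v)) => y.
  case: (EM (exists x, x ≺ y)) => [[x0 x0y]|no]; last first.
    by exists y => x xy; case: no; exists x.
  have [m ym] := ro_nomax ltP y.
  exists (F (e x0) (e y)) => x xy; case: (ro_total ltP x x0) => [xx0|->//|x0x].
  - exact: hl xx0 x0y ym.
  - by rewrite (hl _ _ _ _ x0x xy ym).
case: hr => [hr|hr].
  exists e => //; right; exists true.
  apply: (@functional_choice _ _ (fun x v => forall y, x ≺ y -> F (e x) (e y) = v)) => x.
  have [y0 xy0] := ro_nomax ltP x.
  exists (F (e x) (e y0)) => y xy; case: (ro_total ltP y y0) => [yy0|->//|y0y].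
  - by have [m ym] := ro_nomax ltP y0; exact: hr xy yy0 ym.
  - by have [m ym] := ro_nomax ltP y; rewrite (hr _ _ _ _ xy0 y0y ym).
have nd : nondegenerate (fun x y => F (e x) (e y)).
  split=> [x x' y xx' xy|x y y' xy yy'].
  - by have [m ym] := ro_nomax ltP y; exact: hl xx' xy ym.
  - by have [m ym] := ro_nomax ltP y'; exact: hr xy yy' ym.
have [e' ei' inj] := collision_free (fun x y => F (e x) (e y)) nd.
by exists (e \o e'); [exact: incr_comp|left].
Qed.

Lemma delta_inj_incr F e : incr e -> delta_inj F -> delta_inj (fun x y => F (e x) (e y)).
Proof.
move=> ei Fi x y x' y' /ei xy /ei xy' /(Fi _ _ _ _ xy xy')[].
by move=> /(incr_inj ei) -> /(incr_inj ei) ->.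
Qed.

(** In canonical, the injective case is excluded by hypothesis; the finitely many
    functions are treated one after the other. *)
Lemma canonical_family n (F : 'I_n -> T -> T -> T) :
    (forall i e, incr e -> ~ delta_inj (fun x y => F i (e x) (e y))) ->
  exists2 e, incr e & exists (A : pred 'I_n) (w : 'I_n -> T -> T),
    forall i x y, x ≺ y -> F i (e x) (e y) = w i (if A i then x else y).
Proof.
move=> Fni.
suff [e ei eP] : exists2 e, incr e & forall i, i \in enum 'I_n ->
    exists (b : bool) w, forall x y, x ≺ y -> F i (e x) (e y) = w (if b then x else y).
  exists e => //.
  have [bw bwP] : exists bw : 'I_n -> bool * (T -> T), forall i x y, x ≺ y ->
      F i (e x) (e y) = (bw i).2 (if (bw i).1 then x else y).
    apply: (@functional_choice _ _ (fun i (bw : bool * (T -> T)) => forall x y, x ≺ y ->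
      F i (e x) (e y) = bw.2 (if bw.1 then x else y))) => i.
    by have [|b [w bwP]] := eP i; [rewrite mem_enum|exists (b, w)].
  by exists (fun i => (bw i).1), (fun i => (bw i).2).
elim: (enum _) => [|j s [e ei IH]]; first by exists id.
have [e' ei' he'] := canonical (fun x y => F j (e x) (e y)).
exists (e \o e'); first exact: incr_comp.
move=> i; rewrite inE => /orP[/eqP->|/IH[b [w bw]]].
  by case: he' => // /(Fni j (e \o e') (incr_comp ei ei')).
by exists b, (w \o e') => x y /ei' /bw -> /=; case: b {bw}.
Qed.

Variable o : T.

Lemma delta_inj_nunary u (b : bool) : ~ delta_inj (fun x y => u (if b then x else y)).
Proof.
have [c2 c12] := ro_nomax ltP o; have [c3 c23] := ro_nomax ltP c2.
have c13 := lt_trans c12 c23; case: b => inj.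
- by have [//|_ eq] := inj o c2 o c3 c12 c13; apply: (ro_irr (x := c2)); rewrite {2}eq.
- by have [//|eq _] := inj o c3 c2 c3 c13 c23; apply: (ro_irr (x := o)); rewrite {2}eq.
Qed.

(** * The two clones *)
Definition box_bounded n (f : opn T n) (A : pred 'I_n) := forall a, exists b,
  forall x, (forall i, A i -> x i ≺ a) -> f x ≺ b.

Definition split_bounded : set (op T) := [set g : op T |
  forall A : pred 'I_(projT1 g).+1,
    @box_bounded (projT1 g).+1 (projT2 g) A \/
    @box_bounded (projT1 g).+1 (projT2 g) (predC A)].

Definition never_injective : set (op T) := [set g : op T |
  ~ exists (A : pred 'I_(projT1 g).+1) (u : 'I_(projT1 g).+1 -> T -> T),
      delta_inj (fun x y => projT2 g (fun i => u i (if A i then x else y)))].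

Local Notation C1 := split_bounded.
Local Notation C2 := never_injective.

Lemma finite_bound n (v : 'I_n -> T) : exists b, forall i, v i ≺ b.
Proof.
suff [b bP] : exists b, forall i, i \in enum 'I_n -> v i ≺ b.
  by exists b => i; apply: bP; rewrite mem_enum.
elim: (enum _) => [|j s [b bP]]; first by exists o.
have [c [bc jc]] := ro_ub2 b (v j); exists c => i.
by rewrite inE => /orP[/eqP->//|/bP h]; exact: lt_trans bc.
Qed.

(** Given a set A of variables of the composite, apply the property of the outer
    operation to the set of inner operations that are bounded along A; the other
    ones are bounded along the complement of A. *)
Lemma clone_split_bounded : clone C1.
Proof.
split=> [n k A|n k g f Cg Cf A].
  by rewrite /proj /=; case: (boolP (A k)) => Ak; [left|right] => a; exists a => x; exact.
pose I : pred 'I_k.+1 := fun i => `[< box_bounded (f i) A >].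
have comp_bounded J B : box_bounded g J -> (forall i, J i -> box_bounded (f i) B) ->
    box_bounded (Defs.comp g f) B.
  move=> gJ fJ a.
  have [v vP] : exists v : 'I_k.+1 -> T, forall i, J i -> forall x,
      (forall j, B j -> x j ≺ a) -> f i x ≺ v i.
    apply: (@functional_choice _ _ (fun i c => J i -> forall x,
      (forall j, B j -> x j ≺ a) -> f i x ≺ c)) => i.
    by case: (EM (J i)) => [/fJ/(_ a)[b]|]; [exists b|exists o].
  have [c cP] := finite_bound v; have [b bP] := gJ c.
  by exists b => x Bx; apply: bP => i Ji; exact: lt_trans (vP _ Ji _ Bx) (cP i).
case: (Cg I) => gI; [left|right]; apply: (comp_bounded _ _ gI) => i.
- by move=> /asboolP.
- by move=> /= /asboolP nA; case: (Cf i A).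
Qed.

Lemma split_bounded_unary f : C1 (unary f).
Proof.
have bnd (A : pred _) : A ord0 -> @box_bounded 1 (projT2 (unary f)) A.
  by move=> A0 a; have [b bP] := ro_regular ltP f a; exists b => x /(_ _ A0); exact: bP.
by move=> A; case: (boolP (A ord0)) => A0; [left|right]; apply: bnd.
Qed.

(** After the substitution, no inner operation is injective on a triangle, so on a
    large set each is a unary function of x or of y. These functions are then a
    substitution making the outer operation injective. *)
Lemma clone_never_injective : clone C2.
Proof.
split=> [n k [A [u]]|n k g f Cg Cf [A [u inj]]]; first exact: delta_inj_nunary.
have [|e ei [B [w fw]]] := canonical_family (F := fun i x y =>
    f i (fun j => u j (if A j then x else y))).
  move=> i e ei h; apply: (Cf i); exists A, (fun j => u j \o e).
  by move: h; congr delta_inj; apply/funext => x; apply/funext => y /=;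
    congr (f i _); apply/funext => j; case: (A j).
have E x y : x ≺ y ->
    Defs.comp g f (fun i => u i (if A i then e x else e y)) =
    g (fun i => w i (if B i then x else y)).
  by move=> xy; congr g; apply/funext => i; exact: fw.
apply: Cg; exists B, w => x y x' y' xy xy' eq.
apply: (delta_inj_incr ei inj xy xy').
exact: etrans (E _ _ xy) (etrans eq (esym (E _ _ xy'))).
Qed.

Lemma never_injective_unary f : C2 (unary f).
Proof. by move=> [A [u]]; exact: (@delta_inj_nunary (f \o u ord0)). Qed.

Definition binary (f : T -> T -> T) : op T := @mkop T 1 (fun x => f (x ord0) (x ord_max)).

(** The witness is the maximum. It equals one of its two arguments and, on a large
    set, always the same one: it cannot be injective on a triangle. *)
Lemma never_injective_not_sub : exists2 g, C2 g & ~ C1 g.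
Proof.
pose mx x y := if pselect (x ≺ y) then y else x.
have mxr x y : ~ mx x y ≺ y by rewrite /mx; case: pselect => //= _; exact: ro_irr.
have mxl x y : ~ mx x y ≺ x.
  rewrite /mx; case: pselect => xy; last exact: ro_irr.
  by move=> yx; exact: ro_irr (lt_trans xy yx).
exists (binary mx) => [[A [u inj]]|/(_ (pred1 ord0))].
  pose z (i : 'I_2) x y := u i (if A i then x else y).
  pose F x y := mx (z ord0 x y) (z ord_max x y).
  have FE x y : F x y = z ord0 x y \/ F x y = z ord_max x y.
    by rewrite /F /mx; case: pselect; [right|left].
  have [S [Sub hS]] := ro_homogeneous ltP (fun x y => F x y = z ord0 x y).
  have [e [ei eS _]] := sparse_enumeration id Sub.
  have [i Fi] : exists i, forall x y, x ≺ y -> F (e x) (e y) = z i (e x) (e y).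
    case: hS => h; [exists ord0|exists ord_max] => x y xy.
      by apply: h => //; exact: ei.
    by case: (FE (e x) (e y)) => // /(h _ _ (eS x) (eS y) (ei _ _ xy)).
  apply: (@delta_inj_nunary (u i \o e) (A i)) => x y x' y' xy xy' /= eq.
  apply: (delta_inj_incr ei inj xy xy').
  apply: etrans (Fi _ _ xy) (etrans _ (esym (Fi _ _ xy'))).
  by rewrite /z; move: eq; case: (A i).
have [a oa] := ro_nomax ltP o.
case=> /(_ a)[b /=].
- move/(_ (fun i => if i == ord0 then o else b)) => /= h; apply: (mxr o b).
  by apply: h => i /eqP->.
- move/(_ (fun i => if i == ord0 then b else o)) => /= h; apply: (mxl b o).
  by apply: h => i /negbTE->.
Qed.

(** Extending a code of the triangle by a constant gives an operation bounded
    along its second variable, since x < y bounds the first one. *)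
Lemma split_bounded_not_sub : exists2 g, C1 g & ~ C2 g.
Proof.
have [q qi] := delta_code.
pose p x y := if pselect (x ≺ y) then q x y else o.
exists (binary p).
  have bnd (A : pred _) : A ord_max -> @box_bounded 2 (projT2 (binary p)) A.
    move=> A1 a; have [b bP] := ro_bound2 q a; have [c [bc oc]] := ro_ub2 b o.
    exists c => x /(_ _ A1) xa; rewrite /= /p; case: pselect => //= xy.
    by apply: lt_trans bc; apply: bP => //; exact: lt_trans xa.
  by move=> A; case: (boolP (A ord_max)) => A0; [left|right]; apply: bnd.
apply; exists (pred1 ord0), (fun=> id) => x y x' y' xy xy' /=.
rewrite /p; case: pselect => //= _; case: pselect => //= _; exact: qi.
Qed.


(** * Generating all operations *)
Section Generation.
Variable D : set (op T).
Hypotheses (cD : clone D) (uD : range (@unary T) `<=` D).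

Lemma clone_merge n (f : opn T n.+1) (A : pred 'I_n.+1) (u : 'I_n.+1 -> T -> T) :
  D (mkop f) -> D (binary (fun x y => f (fun i => u i (if A i then x else y)))).
Proof.
move=> Df; pose v i (z : 'I_2 -> T) := u i (z (if A i then ord0 else ord_max)).
have -> : binary (fun x y => f (fun i => u i (if A i then x else y))) =
    mkop (Defs.comp f v : opn T 2).
  rewrite /binary /Defs.comp /v; congr mkop; apply/funext => z; congr f.
  by apply/funext => i; case: (A i).
apply: cD.2 => // i.
exact: (cD.2 1 0 (fun x => u i (x ord0)) (fun=> @proj T 2 (if A i then ord0 else ord_max))
  (uD (ex_intro2 _ _ (u i) I erefl)) (fun=> cD.1 1 _)).
Qed.

Lemma clone_proj2 (u : T -> T) (b : bool) : D (binary (fun x y => u (if b then x else y))).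
Proof. exact: (@clone_merge 0 (fun x => x ord0) (fun=> b) (fun=> u) (cD.1 0 ord0)). Qed.

Lemma clone_comp2 p f g : D (binary p) -> D (binary f) -> D (binary g) ->
  D (binary (fun x y => p (f x y) (g x y))).
Proof.
move=> Dp Df Dg.
pose h (i : 'I_2) : opn T 2 := if i == ord0 then projT2 (binary f) else projT2 (binary g).
apply: (cD.2 1 1 _ h Dp) => i; rewrite /h.
by case: ifP.
Qed.

Lemma clone_comp1 u f : D (binary f) -> D (binary (fun x y => u (f x y))).
Proof. by move=> Df; exact: (clone_comp2 (clone_proj2 u true) Df Df). Qed.

Lemma clone_sub2 f (u v : T -> T) : D (binary f) -> D (binary (fun x y => f (u x) (v y))).
Proof.
by move=> Df; exact: (clone_comp2 Df (clone_proj2 u true) (clone_proj2 v false)).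
Qed.

Lemma clone_swap f : D (binary f) -> D (binary (fun x y => f y x)).
Proof.
by move=> Df; exact: (clone_comp2 Df (clone_proj2 id false) (clone_proj2 id true)).
Qed.

(** Iterating p gives injective operations of every arity, from which any
    operation is obtained by composing with a unary one. *)
Lemma pairing_generates p : (forall x y x' y', p x y = p x' y' -> x = x' /\ y = y') ->
  D (binary p) -> D = setT.
Proof.
move=> pi Dp.
suff J n : exists2 f : opn T n.+1, D (mkop f) & injective f.
  apply/seteqP; split=> // -[n f] _; have [j Dj ji] := J n.
  have [w wj] : exists w : T -> T, forall x, w (j x) = f x.
    have [w wP] : exists w : T -> T, forall t x, j x = t -> w t = f x.
      apply: (@functional_choice _ _ (fun t v => forall x, j x = t -> v = f x)) => t.
      case: (EM (exists x, j x = t)) => [[x jx]|no].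
        by exists (f x) => x' jx'; congr f; apply: ji; rewrite jx jx'.
      by exists o => x jx; case: no; exists x.
    by exists w => x; exact: wP.
  have -> : existT _ n f = mkop (Defs.comp (fun x : 'I_1 -> T => w (x ord0)) (fun=> j)).
    by congr existT; apply/funext => x; rewrite /Defs.comp wj.
  apply: cD.2 => //; apply: uD; exact: (ex_intro2 _ _ w I erefl).
elim: n => [|n [f Df fi]].
  exists (@proj T 1 ord0); first exact: cD.1.
  by move=> x y xy; apply/funext => i; rewrite ord1.
pose r : opn T n.+2 := Defs.comp f (fun i => @proj T n.+2 (widen_ord (leqnSn _) i)).
pose h (i : 'I_2) : opn T n.+2 := if i == ord0 then r else @proj T n.+2 ord_max.
exists (Defs.comp (projT2 (binary p)) h).
  apply: cD.2 => // i; rewrite /h; case: ifP => _; last exact: cD.1.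
  by apply: cD.2 => // j; exact: cD.1.
move=> x y /pi[/fi xy lst]; apply/funext => i.
case: (ltnP i n.+1) => ilt.
  have -> : i = widen_ord (leqnSn _) (Ordinal ilt) by exact: val_inj.
  exact: (congr1 (fun z => z (Ordinal ilt)) xy).
have -> // : i = ord_max.
by apply: val_inj; apply/eqP; rewrite eqn_leq ilt -ltnS ltn_ord.
Qed.

(** The coordinates in A range over a bounded set while f is unbounded; by
    regularity they can be made constant one at a time. *)
Lemma fixed_coordinates n (f : opn T n) (A : pred 'I_n) : ~ box_bounded f A ->
  exists v : 'I_n -> T, forall b, exists2 x, (forall i, A i -> x i = v i) & b ≺ f x.
Proof.
move=> nb.
have [a aP] : exists a, forall b, exists2 x, (forall i, A i -> x i ≺ a) & b ≺ f x.
  apply: contrapT => no; apply: nb => a; apply: contrapT => nob; apply: no.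
  exists a => b; have [c bc] := ro_nomax ltP b.
  apply: contrapT => nox; apply: nob; exists c => x xa; apply: contrapT => nfx.
  by apply: nox; exists x => //; exact: ro_lt_nlt bc nfx.
suff [v vP] : exists v : 'I_n -> T, forall b, exists2 x,
    (forall i, A i -> x i ≺ a) /\ (forall i, i \in enum 'I_n -> A i -> x i = v i) & b ≺ f x.
  exists v => b; have [x [_ xv] bx] := vP b; exists x => // i; apply: xv.
  by rewrite mem_enum.
elim: (enum _) => [|j s [v vP]].
  by exists (fun=> o) => b; have [x xa bx] := aP b; exists x.
case: (boolP (A j)) => Aj; last first.
  exists v => b; have [x [xa xv] bx] := vP b; exists x => //; split=> // i.
  by rewrite inE => /orP[/eqP-> /(negP Aj)//|]; exact: xv.
apply: contrapT => no.
have [beta bP] : exists beta : T -> T, forall c x, (forall i, A i -> x i ≺ a) ->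
    (forall i, i \in s -> A i -> x i = v i) -> x j = c -> ~ beta c ≺ f x.
  apply: (@functional_choice _ _ (fun c b => forall x, (forall i, A i -> x i ≺ a) ->
    (forall i, i \in s -> A i -> x i = v i) -> x j = c -> ~ b ≺ f x)) => c.
  apply: contrapT => nob; apply: no.
  exists (fun i => if i == j then c else v i) => b.
  apply: contrapT => nox; apply: nob; exists b => x xa xv xj bx; apply: nox.
  exists x => //; split=> // i; rewrite inE; case: eqP => [->|_] //=; exact: xv.
have [b bb] := ro_regular ltP beta a.
have [x [xa xv] bx] := vP b.
exact: (bP (x j) x xa xv erefl (lt_trans (bb _ (xa _ Aj)) bx)).
Qed.

(** Outside split_bounded, f is unbounded both with its A-coordinates fixed to a
    and with the others fixed to b. Interleaving two sequences with rapidly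
    growing values makes the values of f distinct, and the special value o of the
    arguments is sent to the fixed coordinates a and b. *)
Lemma axes_injective : ~ D `<=` C1 -> exists (h : T -> T -> T) (c : T) (k : T -> T), [/\ D (binary h),
  injective k /\ (forall x, k x <> c),
  (forall x x', h (k x) c = h (k x') c -> x = x'),
  (forall y y', h c (k y) = h c (k y') -> y = y') &
  (forall x y, h (k x) c <> h c (k y))].
Proof.
move=> nD.
have [[n f] [Df nf]] := nonsubset nD.
have [A /not_orP[/fixed_coordinates[a aP] /fixed_coordinates[b bP]]] :
    exists A, ~ (box_bounded f A \/ box_bounded f (predC A)).
  by apply: contrapT => no; apply: nf => A; apply: contrapT => nA; apply: no; exists A.
have [s sP] : exists s : T -> 'I_n.+1 -> T, forall d,
    (forall i, A i -> s d i = a i) /\ d ≺ f (s d).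
  apply: (@functional_choice _ _ (fun d x => (forall i, A i -> x i = a i) /\ d ≺ f x)) => d.
  by have [x xa dx] := aP d; exists x.
have [t tP] : exists t : T -> 'I_n.+1 -> T, forall d,
    (forall i, ~~ A i -> t d i = b i) /\ d ≺ f (t d).
  apply: (@functional_choice _ _ (fun d x => (forall i, ~~ A i -> x i = b i) /\ d ≺ f x)) => d.
  by have [x xa dx] := bP d; exists x.
have [e [ei eN]] := sparse_incr (fun z => f (s (f (t z)))).
pose psi x := f (t (e x)); pose phi x := f (s (psi x)).
have e_psi x : e x ≺ psi x by case: (tP (e x)).
have psi_phi x : psi x ≺ phi x by case: (sP (psi x)).
have phi_e x y : x ≺ y -> phi x ≺ e y by exact: eN.
have psi_incr : incr psi.
  by move=> x y xy; exact: lt_trans (psi_phi x) (lt_trans (phi_e _ _ xy) (e_psi y)).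
have phi_incr : incr phi.
  by move=> x y xy; exact: lt_trans (phi_e _ _ xy) (lt_trans (e_psi y) (psi_phi y)).
have psi_neq_phi x y : psi x <> phi y.
  move=> eq; case: (ro_total ltP y x) => [yx|yx|xy].
  - apply: (ro_irr (x := psi x)); rewrite {1}eq.
    exact: lt_trans (phi_e _ _ yx) (e_psi x).
  - by apply: (ro_irr (x := psi x)); rewrite {2}eq yx.
  - apply: (ro_irr (x := psi x)); rewrite {2}eq.
    exact: lt_trans (psi_incr _ _ xy) (psi_phi y).
have [|k [ki ck _]] := sparse_enumeration (S := fun z => o ≺ z) id.
  by move=> d; have [m [om dm]] := ro_ub2 o d; exists m.
have ko x : k x <> o by move=> eq; move: (ck x); rewrite eq; exact: ro_irr.
pose u i x := if pselect (x = o) then (if A i then a i else b i)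
              else if A i then t (e x) i else s (psi x) i.
pose h x y := f (fun i => u i (if A i then x else y)).
have hpsi x : h (k x) o = psi (k x).
  rewrite /h /psi; congr f; apply/funext => i; rewrite /u.
  case: (boolP (A i)) => Ai; first by case: pselect => /= [/ko|].
  by case: pselect => //= _; rewrite (tP _).1.
have hphi y : h o (k y) = phi (k y).
  rewrite /h /phi; congr f; apply/funext => i; rewrite /u.
  case: (boolP (A i)) => Ai; last by case: pselect => /= [/ko|].
  by case: pselect => //= _; rewrite (sP _).1.
exists h, o, k; split.
- exact: clone_merge.
- by split=> //; exact: incr_inj.
- by move=> x x'; rewrite !hpsi => /(incr_inj psi_incr)/(incr_inj ki).
- by move=> x x'; rewrite !hphi => /(incr_inj phi_incr)/(incr_inj ki).
- by move=> x y; rewrite hpsi hphi.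
Qed.

(** The operation q given by an element outside never_injective is first made
    symmetric or free of collisions between the two triangles, which collision_free
    and the partition of pairs permit. *)
Lemma unbounded_and_injective_generate : ~ D `<=` C1 -> ~ D `<=` C2 -> D = setT.
Proof.
move=> /axes_injective[h [c [k [Dh [ki kc] h1 h2 h12]]]] nD.
have [q Dq qi] : exists2 q, D (binary q) & delta_inj q.
  have [[n f] [Df nf]] := nonsubset nD.
  move: nf => /contrapT[A [u inj]].
  by exists (fun x y => f (fun i => u i (if A i then x else y))) => //; exact: (@clone_merge n f A u Df).
have nd : nondegenerate q.
  split=> [x x' y xx' xy|x y y' xy yy'] eq.
  - have [eqx _] := qi _ _ _ _ (lt_trans xx' xy) xy eq.
    by apply: (ro_irr (x := x)); rewrite {2}eqx.
  - have [_ eqy] := qi _ _ _ _ xy (lt_trans xy yy') eq.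
    by apply: (ro_irr (x := y)); rewrite {2}eqy.
have [e ei coll] := collision_free (fun x y => q y x) nd.
have [S [Sub hS]] := ro_homogeneous ltP (fun x y => q (e y) (e x) = q (e x) (e y)).
have [e' [ei' eS _]] := sparse_enumeration id Sub.
pose r x y := q (e (e' x)) (e (e' y)).
have Dr : D (binary r) by exact: (clone_sub2 (e \o e') (e \o e') Dq).
have ri : delta_inj r by exact: (delta_inj_incr (incr_comp ei ei') qi).
have [a [b [ai bi ab]]] := disjoint_incr.
have tot x y : ~ a x ≺ b y -> b y ≺ a x.
  by case: (ro_total ltP (a x) (b y)) => // /ab.
(* a and b have disjoint ranges, so (a x, b y) is never on the diagonal. *)
have same x y x' y' : a x = a x' /\ b y = b y' -> x = x' /\ y = y'.
  by case=> /(incr_inj ai) -> /(incr_inj bi) ->.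
case: hS => hS.
  have sym x y : x ≺ y -> r y x = r x y by move=> xy; apply: hS => //; exact: ei'.
  apply: (@pairing_generates (fun x y => r (a x) (b y))); last exact: (clone_sub2 a b Dr).
  move=> x y x' y' eq; apply: same.
  case: (EM (a x ≺ b y)) => [xy|/tot xy]; case: (EM (a x' ≺ b y')) => [xy'|/tot xy'].
  - exact: ri.
  - by move: eq; rewrite (sym _ _ xy') => /(ri _ _ _ _ xy xy')[/ab].
  - by move: eq; rewrite (sym _ _ xy) => /(ri _ _ _ _ xy xy')[/esym/ab].
  - by move: eq; rewrite (sym _ _ xy) (sym _ _ xy') => /(ri _ _ _ _ xy xy')[].
have asym x y x' y' : x ≺ y -> x' ≺ y' -> r y x <> r x' y'.
  move=> xy xy' eq; have [||ex ey] := coll (e' x) (e' y) (e' x') (e' y') _ _ eq.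
  - exact: ei'.
  - exact: ei'.
  by apply: (hS (e' x) (e' y)) => //; [exact: ei'|rewrite [LHS]eq /r ex ey].
pose w v := if pselect (exists x y, x ≺ y /\ r x y = v) then k v else c.
have wup x y : x ≺ y -> w (r x y) = k (r x y).
  by move=> xy; rewrite /w; case: pselect => // no; case: no; exists x, y.
have wdown x y : x ≺ y -> w (r y x) = c.
  move=> xy; rewrite /w; case: pselect => /= [[x' [y' [xy' /esym]]]|] //.
  by move/(asym _ _ _ _ xy xy').
pose p x y := h (w (r (a x) (b y))) (w (r (b y) (a x))).
apply: (@pairing_generates p); last first.
  apply: (clone_comp2 Dh); apply: clone_comp1; first exact: (clone_sub2 a b Dr).
  exact: (clone_sub2 a b (clone_swap Dr)).
have pup x y : a x ≺ b y -> p x y = h (k (r (a x) (b y))) c.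
  by move=> xy; rewrite /p (wup _ _ xy) (wdown _ _ xy).
have pdown x y : b y ≺ a x -> p x y = h c (k (r (b y) (a x))).
  by move=> xy; rewrite /p (wup _ _ xy) (wdown _ _ xy).
move=> x y x' y' eq; apply: same; move: eq.
case: (EM (a x ≺ b y)) => [xy|/tot xy]; case: (EM (a x' ≺ b y')) => [xy'|/tot xy'].
- by rewrite !pup// => /h1; exact: ri.
- by rewrite pup// pdown// => /h12.
- by rewrite pdown// pup// => /esym/h12.
- by rewrite !pdown// => /h2/(ri _ _ _ _ xy xy')[].
Qed.

End Generation.

Lemma two_maximal_clones :
  [set C : set (op T) | precomplete C /\ range (@unary T) `<=` C] = [set C1; C2].
Proof.
have [f1 f1C1 f1C2] := split_bounded_not_sub; have [f2 f2C2 f2C1] := never_injective_not_sub.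
have u1 : range (@unary T) `<=` C1 by move=> _ [f _ <-]; exact: split_bounded_unary.
have u2 : range (@unary T) `<=` C2 by move=> _ [f _ <-]; exact: never_injective_unary.
apply/seteqP; split=> C.
  move=> [[cC CnT Cmax] uC].
  have [sub|nsub1] := EM (C `<=` C1); first left.
    apply: contrapT => neq; have : C1 = setT.
      by apply: (Cmax _ clone_split_bounded); split=> // sub'; apply: neq; apply/seteqP.
    by move=> C1T; apply: f2C1; rewrite C1T.
  have [sub|nsub2] := EM (C `<=` C2); first right.
    apply: contrapT => neq; have : C2 = setT.
      by apply: (Cmax _ clone_never_injective); split=> // sub'; apply: neq; apply/seteqP.
    by move=> C2T; apply: f1C2; rewrite C2T.
  by case: CnT; exact: (unbounded_and_injective_generate cC uC).
case=> ->; split=> //.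
- split; first exact: clone_split_bounded.
    by move=> C1T; apply: f2C1; rewrite C1T.
  move=> D cD [sub nsub]; apply: (unbounded_and_injective_generate cD) => //.
    exact: subset_trans sub.
  by move=> /(_ _ (sub _ f1C1)).
- split; first exact: clone_never_injective.
    by move=> C2T; apply: f1C2; rewrite C2T.
  move=> D cD [sub nsub]; apply: (unbounded_and_injective_generate cD) => //.
    exact: subset_trans sub.
  by move=> /(_ _ (sub _ f2C2)).
Qed.

Lemma split_bounded_neq_never_injective : C1 <> C2.
Proof. by have [f f1 f2] := split_bounded_not_sub => eq; apply: f2; rewrite -eq. Qed.

End RamseyOrder.

(** * The Ramsey order of a weakly compact cardinal *)
Lemma card_pair T (x y : T) : x <> y -> [set x; y] #= `I_2.
Proof.
move=> xy; apply/card_set_bijP.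
exists (fun z => if pselect (z = x) then 0%N else 1%N); split.
- by move=> z _; case: pselect.
- move=> z z' /set_mem[->|->] /set_mem[->|->] //; by do 2 case: pselect => //=.
- move=> [|[|//]] _.
  + by exists x; [left|case: pselect => /=].
  + by exists y; [right|case: pselect => //= /esym].
Qed.

Definition embeds T (A : set T) := exists2 f : T -> T, injective f & forall x, A (f x).

Lemma card_embeds T (A : set T) : A #= [set: T] -> embeds A.
Proof.
rewrite card_eq_le => /andP[_]; elim/Ppointed: T A => T A.
  by move=> _; exists id => // x; case: (no x).
move=> /pcard_leP[f]; exists f => [x y|x]; last exact: funS.
by apply: inj; exact: mem_setT.
Qed.

Lemma embeds_sub T (A B : set T) : A `<=` B -> embeds A -> embeds B.
Proof. by move=> AB [f fi fA]; exists f => // x; exact: AB. Qed.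

Definition strict_well_order T (lt : T -> T -> Prop) := [/\ well_founded lt,
  (forall x y z, lt x y -> lt y z -> lt x z) &
  (forall x y, [\/ lt x y, x = y | lt y x])].

Lemma strict_well_order_exists T : exists lt : T -> T -> Prop, strict_well_order lt.
Proof.
have [R Rwo] := wochoice.well_ordering_principle {classic T}.
have min (P : T -> Prop) x : P x -> exists m, [/\ P m, forall z, P z -> R m z &
    forall m', P m' -> (forall z, P z -> R m' z) -> m = m'].
  move=> Px; have [|m [[Pm mR] um]] := Rwo (fun z => `[< P z >]).
    by exists x; apply/asboolP.
  exists m; split; first exact/asboolP.
    by move=> z Pz; apply: mR; apply/asboolP.
  move=> m' Pm' m'R; apply: um; split; first exact/asboolP.
  by move=> z /asboolP; exact: m'R.
have refl x : R x x by have [m [-> mR _]] := min (eq x) x erefl; exact: mR.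
have tot x y : R x y \/ R y x.
  have [m [Pm mR _]] := min (fun z => z = x \/ z = y) x (or_introl erefl).
  by case: Pm mR => -> mR; [left|right]; apply: mR; [right|left].
have anti x y : R x y -> R y x -> x = y.
  move=> xy yx.
  have [m [_ _ um]] := min (fun z => z = x \/ z = y) x (or_introl erefl).
  rewrite -(um x) ?(um y) //; [by right|by move=> z [->|->]|by left|by move=> z [->|->]].
exists (fun x y => ~ R y x); split.
- move=> x; apply: contrapT => /(min (fun z => ~ Acc _ z))[m [nm mR _]].
  by apply: nm; split=> y yx; apply: contrapT => ny; apply: yx; exact: mR.
- move=> x y z nyx nzy zx.
  have [m [Pm mR _]] := min (fun w => [\/ w = x, w = y | w = z]) x (Or31 _ _ erefl).
  case: (EM (x = z)) => [xz|xz]; first by case: (tot x y) => //; rewrite xz.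
  case: Pm mR => -> mR.
  + by apply: xz; apply: anti => //; apply: mR; exact: Or33.
  + by apply: nyx; apply: mR; exact: Or31.
  + by apply: nzy; apply: mR; exact: Or32.
- move=> x y; case: (EM (R y x)) => [yx|]; last by move=> ?; exact: Or31.
  case: (EM (R x y)) => [xy|]; last by move=> ?; exact: Or33.
  by apply: Or32; exact: anti.
Qed.

(** If some initial segment has the size of T, pull back the order along an
    embedding into the least such segment. *)
Lemma initial_order T : exists2 lt : T -> T -> Prop, strict_well_order lt &
  forall a, ~ embeds [set x | lt x a].
Proof.
have [lt [wf trans tot]] := strict_well_order_exists T.
case: (EM (exists a, embeds [set x | lt x a])) => [[a0 ha0]|no]; last first.
  by exists lt => // a ha; apply: no; exists a.
have [a ha mina] : exists2 a, embeds [set x | lt x a] &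
    forall b, lt b a -> ~ embeds [set x | lt x b].
  elim/(well_founded_ind wf): a0 ha0 => a IH ha.
  case: (EM (exists2 b, lt b a & embeds [set x | lt x b])) => [[b ba hb]|no].
    exact: IH ba hb.
  by exists a => // b ba hb; apply: no; exists b.
have [phi phi_inj phia] := ha.
exists (fun x y => lt (phi x) (phi y)).
  split=> [x|x y z|x y]; last 2 first.
  - exact: trans.
  - by case: (tot (phi x) (phi y)) => [|/phi_inj|]; [exact: Or31|exact: Or32|exact: Or33].
  - move: {2}(phi x) (erefl (phi x)) => b.
    elim/(well_founded_ind wf): b x => b IH x xb; split=> y yx.
    by apply: IH erefl; rewrite -xb.
move=> b [f fi fb]; apply: (mina _ (phia b)).
by exists (phi \o f) => //; exact: inj_comp.
Qed.

(** Shifting a countable sequence frees its first term f 0, which is then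
    exchanged with m. *)
Lemma infinite_avoids T (m : T) : ~ countable [set: T] -> embeds [set x | x <> m].
Proof.
move=> nc; have /infiniteP : infinite_set [set: T] by move=> /finite_set_countable.
elim/Ppointed: T m nc => T m nc; first by case: (no m).
move=> /pcard_leP[f].
have fi i j : f i = f j -> i = j by apply: inj; exact: mem_setT.
pose g x := if pselect (exists i, f i = x) is left h then f (projT1 (cid h)).+1 else x.
have gi : injective g.
  move=> x y; rewrite /g; case: pselect => [h|nx]; case: pselect => [h'|ny].
  - by case: (cid h) => i hi; case: (cid h') => j hj /= /fi[ij]; rewrite -hi -hj ij.
  - by move=> eq; case: ny; eexists; exact: eq.
  - by move=> eq; case: nx; eexists; exact: esym eq.
  - by [].
have g0 x : g x <> f 0%N.
  by rewrite /g; case: pselect => [h /fi//|nx eq]; apply: nx; exists 0%N.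
exists (fun x => if pselect (g x = m) then f 0%N else g x) => [x y|x] /=.
  case: pselect => hx; case: pselect => hy //= eq; last exact: gi.
  - by apply: gi; rewrite hx hy.
  - by case: (g0 y).
  - by case: (g0 x).
by case: pselect => //= hx eq; apply: (g0 x); rewrite hx eq.
Qed.

(** Regularity: if F were unbounded on the elements before a, choose for each y
    some g y before a with y < F (g y). A large set homogeneous for the equality
    of g would be contained in a proper initial segment if g is constant on it,
    and embedded by g in the one of a if g is injective on it. *)
Lemma weakly_compact_order T : weakly_compact T ->
  exists lt : T -> T -> Prop, ramsey_order lt.
Proof.
move=> [nc part]; have [lt [wf trans tot] small] := initial_order T.
have irr x : ~ lt x x by elim/(well_founded_ind wf): x => x IH xx; exact: (IH x xx xx).
have nomax x : exists y, lt x y.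
  apply: contrapT => no; apply: (small x); apply: embeds_sub (infinite_avoids x nc).
  move=> y /= yx; case: (tot x y) => [xy||//]; last by move/esym.
  by case: no; exists y.
have unbdd S : embeds S -> forall b, exists2 s, S s & lt b s.
  move=> eS b; have [c bc] := nomax b; apply: contrapT => no; apply: (small c).
  apply: embeds_sub eS => s Ss /=; case: (tot b s) => [bs|<-//|sb]; last exact: trans bc.
  by case: no; exists s.
have homog (P : T -> T -> Prop) : exists2 S : set T, embeds S &
    (forall x y, S x -> S y -> lt x y -> P x y) \/
    (forall x y, S x -> S y -> lt x y -> ~ P x y).
  have [S [/card_embeds eS [c hc]]] :=
    part (fun A => `[< exists x y, [/\ lt x y, A = [set x; y] & P x y] >]).
  exists S => //.
  have hS x y : S x -> S y -> lt x y ->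
      `[< exists x' y', [/\ lt x' y', [set x; y] = [set x'; y'] & P x' y'] >] = c.
    move=> Sx Sy xy; apply: hc; split; first by move=> z [->|->].
    by apply: card_pair => eq; apply: (irr x); rewrite {2}eq.
  case: c hS {hc} => hS; [left|right] => x y Sx Sy xy; have := hS x y Sx Sy xy.
    move=> /asboolP[x' [y' [xy' eq]]].
    have [ex|ex] : [set x'; y'] x by rewrite -eq; left.
      have [ey|-> ] : [set x'; y'] y by rewrite -eq; right.
        by case: (irr x); rewrite {2}ex -ey.
      by rewrite ex.
    have [ey|ey] : [set x'; y'] y by rewrite -eq; right.
      by case: (irr x); apply: trans xy _; rewrite ey ex.
    by case: (irr x); rewrite {2}ex -ey.
  by move=> /asboolP nP Pxy; apply: nP; exists x, y.
exists lt; split=> //; last first.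
  by move=> P; have [S /unbdd uS hS] := homog P; exists S.
move=> F a; apply: contrapT => nob.
have [g gP] : exists g : T -> T, forall y, lt (g y) a /\ lt y (F (g y)).
  apply: (@functional_choice _ _ (fun y x => lt x a /\ lt y (F x))) => y.
  have [z yz] := nomax y; apply: contrapT => no; apply: nob; exists z => x xa.
  case: (tot y (F x)) => [yF|<-//|Fy]; last exact: trans yz.
  by case: no; exists x.
have [S eS hS] := homog (fun y z => g y = g z); case: hS => hS; last first.
  case: eS => f fi fS; apply: (small a); exists (g \o f) => [x y /= eq|x]; last first.
    by case: (gP (f x)).
  apply: fi; case: (tot (f x) (f y)) => // h.
    by case: (hS _ _ (fS x) (fS y) h).
  by case: (hS _ _ (fS y) (fS x) h).
have [f _ fS] := eS.
apply: (small (F (g (f a)))); apply: embeds_sub eS => s Ss /=.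
suff -> : g (f a) = g s by case: (gP s).
by case: (tot (f a) s) => [h|->//|h]; [|symmetry]; exact: hS.
Qed.

Unset Implicit Arguments.
Set Strict Implicit.

Theorem mainTheorem6 (T : Type) (hT : weakly_compact T) :
  [set C : set (op T) | precomplete C /\ range (@unary T) `<=` C] #= `I_2.
Proof.
have [lt ltP] := weakly_compact_order hT.
have [o] : inhabited T.
  by apply: contrapT => no; apply: hT.1; rewrite (_ : setT = set0) //;
    apply/seteqP; split=> // x; case: no.
rewrite (two_maximal_clones ltP o); apply: card_pair; exact: split_bounded_neq_never_injective ltP o.
Qed.
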